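(* Let $\Xi$ be the improper prior on $\mathbb R^n$ defined below, with $\pi_n(t)=e^{-dt\log p}/\sum_{u=0}^ne^{-du\log p}$, $t=0,\dots,n$, for a fixed $d\ge4$. Then for $M$ large enough, \[ \sup_{\beta^0\in\mathbb R^p}\mathbb E_{\beta^0}\,\Xi\big[\gamma\in\mathbb R^n:\|\gamma-X\beta^0\|_2^2>M(t_0\vee1)\log p\ \big|\ Y\big]\to0 \] as $n,p\to\infty$, where $t_0$ is the dimension of $V^0=\{X\beta:S_\beta\subseteq S_{\beta^0}\}$.
   Context: Observations follow $Y=X\beta+\varepsilon$ with $X$ a deterministic real $n\times p$ matrix and $\varepsilon\sim N_n(0,I_n)$; $\mathbb E_{\beta^0}$ is expectation when $Y\sim N_n(X\beta^0,I_n)$; $S_\beta=\{i:\beta_i\ne0\}$. For $S\subset\{1,\dots,p\}$ let $\mathcal Y_S=\{X\beta:S_\beta\subseteq S\}$ (span of columns of $X$ indexed by $S$), and let $\mathcal V$ be the collection of all distinct subspaces $\mathcal Y_S$. The prior $\Xi$: select $t\in\{0,\dots,n\}$ according to $\pi_n$; given $t$, select $V\in\mathcal V$ of dimension $t$ uniformly at random among elements of $\mathcal V$ of dimension $t$; given $V$, $\Xi$ is Lebesgue measure on $V$ if $\dim V\ge1$ and the Dirac mass at $0$ if $V=\{0\}$. The posterior is the probability measure $\Xi[B\mid Y]=\int_Be^{-\|Y-\gamma\|_2^2/2}d\Xi(\gamma)/\int e^{-\|Y-\gamma\|_2^2/2}d\Xi(\gamma)$. Asymptotics: $n,p\to\infty$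 with $X$ depending on $n,p$ and $d$ fixed. *)

(* Defs.v *)
From HB Require Import structures.
From mathcomp Require Import all_boot all_order all_algebra.
From mathcomp Require Import all_classical all_reals all_analysis.
Set Implicit Arguments. Unset Strict Implicit. Unset Printing Implicit Defensive.
Import Order.TTheory GRing.Theory Num.Theory.
Import numFieldNormedType.Exports.
Local Open Scope classical_set_scope.
Local Open Scope ring_scope.

Definition sqnorm (R : realType) (n : nat) (v : 'cV[R]_n) : R :=
  \sum_(i < n) (v i 0) ^+ 2.

(* iterated Lebesgue integral over R^k of a nonnegative extended-real
   function of the coordinates (coordinates with index >= k are 0) *)
Fixpoint iint (R : realType) (k : nat) (f : (nat -> R) -> \bar R) : \bar R :=
  match k with
  | 0 => f (fun _ => 0)
  | k'.+1 => (\int[@lebesgue_measure R]_(x in [set: R])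
                iint k' (fun v => f (fun i => if i == k' then x else v i)))%E
  end.

Definition int_Rn (R : realType) (k : nat) (f : 'cV[R]_k -> \bar R) : \bar R :=
  iint k (fun v => f (\col_(i < k) v i)).

(* generator matrix of Y_S: rows are the columns X_j, j in S (others 0);
   its row space is span{X_j : j in S} = {X beta : S_beta subset S} *)
Definition subsp_mx (R : realType) (n p : nat) (X : 'M[R]_(n, p))
  (S : {set 'I_p}) : 'M[R]_(p, n) :=
  \matrix_(j < p, i < n) (if j \in S then X i j else 0).

Definition subsp (R : realType) (n p : nat) (X : 'M[R]_(n, p))
  (S : {set 'I_p}) : 'M[R]_n := (<< subsp_mx X S >>)%MS.

Definition subspaces (R : realType) (n p : nat) (X : 'M[R]_(n, p)) : seq 'M[R]_n :=
  undup [seq subsp X A | A : {set 'I_p}].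

Definition subspaces_dim (R : realType) (n p : nat) (X : 'M[R]_(n, p)) (t : nat)
  : seq 'M[R]_n := [seq V <- subspaces X | \rank V == t].

Definition is_onb (R : realType) (n t : nat) (V : 'M[R]_n) (Q : 'M[R]_(n, t)) : Prop :=
  (Q^T *m Q = 1%:M) /\ (Q^T == V)%MS.

Definition onb (R : realType) (n t : nat) (V : 'M[R]_n) : 'M[R]_(n, t) :=
  xget 0 [set Q | is_onb V Q].

(* integral over the subspace V w.r.t. the Lebesgue measure on V induced by
   the Euclidean structure (Dirac mass at 0 if V = {0}) *)
Definition int_sub (R : realType) (n : nat) (V : 'M[R]_n)
  (f : 'cV[R]_n -> \bar R) : \bar R :=
  int_Rn (fun z : 'cV[R]_(\rank V) => f (onb (\rank V) V *m z)).

Definition pi_n (R : realType) (d : R) (n p t : nat) : R :=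
  expR (- d * t%:R * ln p%:R) /
  \sum_(u < n.+1) expR (- d * u%:R * ln p%:R).

(* \int_B e^{-||Y-gamma||^2/2} dXi(gamma) *)
Definition post_num (R : realType) (d : R) (n p : nat) (X : 'M[R]_(n, p))
  (B : set 'cV[R]_n) (Y : 'cV[R]_n) : \bar R :=
  (\sum_(t < n.+1)
     (pi_n d n p t / (size (subspaces_dim X t))%:R)%:E *
     \sum_(V <- subspaces_dim X t)
        int_sub V (fun g => ((\1_B g : R) * expR (- sqnorm (Y - g) / 2))%:E))%E.

Definition posterior (R : realType) (d : R) (n p : nat) (X : 'M[R]_(n, p))
  (B : set 'cV[R]_n) (Y : 'cV[R]_n) : R :=
  fine (post_num d X B Y) / fine (post_num d X [set: 'cV[R]_n] Y).

Definition gauss_dens (R : realType) (n : nat) (e : 'cV[R]_n) : R :=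
  (Num.sqrt (2 * pi))^-1 ^+ n * expR (- sqnorm e / 2).

Definition expect (R : realType) (n p : nat) (X : 'M[R]_(n, p)) (beta0 : 'cV[R]_p)
  (g : 'cV[R]_n -> R) : \bar R :=
  int_Rn (fun e => (g (X *m beta0 + e) * gauss_dens e)%:E).

Definition supp (R : realType) (p : nat) (beta : 'cV[R]_p) : {set 'I_p} :=
  [set j | beta j 0 != 0].

Definition t0 (R : realType) (n p : nat) (X : 'M[R]_(n, p)) (beta0 : 'cV[R]_p) : nat :=
  \rank (subsp X (supp beta0)).

(* Main.v *)
(* Write Y = th + e with th = X beta0, and P for the orthogonal projection on a
   model space V of dimension t. The normalizing integral is at least its V^0
   term, which is at least w_{t0} (2 pi)^{t0/2} exp (- |e|^2 / 2). The
   contribution of V to the numerator is bounded with the Chernoff bound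
   1_{|g - th|^2 > r} <= exp ((|g - th|^2 - r) / 8), after which the integral
   over V is Gaussian and explicit. So the posterior mass carried by V is at most
   an explicit ratio R_V, hence at most sqrt R_V because it is at most 1. The
   square root is what makes the expectation over e finite: sqrt R_V times the
   Gaussian density is the exponential of a quadratic form with matrix
   I - (2/3) P, whose determinant is 3^{-t}. There are at most p^t spaces of
   dimension t, so the prior factor p^{-dt}, d >= 4, makes the sum over V
   geometric, and exp (- r / 16) with r = M (t0 \/ 1) log p absorbs
   p^{(d+1) t0 / 2}, leaving a bound 2 / sqrt p. *)
Require Import Defs.
From HB Require Import structures.
From mathcomp Require Import all_boot all_order all_algebra.
From mathcomp Require Import all_classical all_reals all_analysis.
From mathcomp Require Import measurable_realfun ring lra.
Set Implicit Arguments.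
Unset Strict Implicit.
Unset Printing Implicit Defensive.
Import Order.TTheory GRing.Theory Num.Theory.
Local Open Scope classical_set_scope.
Local Open Scope ring_scope.

(** * Iterated integrals: monotonicity, and a class of integrands on which they are linear *)

(** The integral of a nonnegative function is a supremum over the simple functions below it, so
    enlarging the function enlarges the supremum. Measurability does not enter, which allows
    arbitrary sets [B] and the posterior itself as integrands. *)
Lemma le_integral_nonmeasurable d (T : measurableType d) (R : realType)
    (mu : {measure set T -> \bar R}) (f g : T -> \bar R) :
  (forall x, 0 <= f x)%E -> (forall x, f x <= g x)%E ->
  (\int[mu]_x f x <= \int[mu]_x g x)%E.
Proof.
move=> f0 fg.
have g0 x : (0 <= g x)%E by apply: le_trans (fg x).
rewrite !ge0_integralTE//; apply: ereal_sup_le => _ [h hf <-].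
by exists h => // x; apply: le_trans (fg x).
Qed.

Lemma iint_ge0 {R : realType} {k : nat} {f : (nat -> R) -> \bar R} :
  (forall v, 0 <= f v)%E -> (0 <= iint k f)%E.
Proof.
elim: k f => [|k IH] f f0 //=; apply: integral_ge0 => x _.
by apply: IH => v.
Qed.

Lemma le_iint {R : realType} {k : nat} {f g : (nat -> R) -> \bar R} :
  (forall v, 0 <= f v)%E -> (forall v, f v <= g v)%E -> (iint k f <= iint k g)%E.
Proof.
elim: k f g => [|k IH] f g f0 fg //=; apply: le_integral_nonmeasurable => x.
  by apply: iint_ge0 => v.
by apply: IH => v.
Qed.

(* [iint] of [F] is the real number [c], with measurable partial integrals: a
   class of integrands on which [iint] is linear, which the bare iterated
   integral is not. *)
Fixpoint has_iint (R : realType) (k : nat) (F : (nat -> R) -> R) (c : R) : Prop :=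
  match k with
  | 0 => F (fun _ => 0) = c
  | k'.+1 => exists g : R -> R,
      [/\ measurable_fun setT g, (forall x, 0 <= g x),
          (forall x, has_iint k' (fun v => F (fun i => if i == k' then x else v i)) (g x))
        & (\int[@lebesgue_measure R]_x (g x)%:E = c%:E)%E]
  end.

Lemma has_iintE {R : realType} {k : nat} {F : (nat -> R) -> R} {c : R} :
  has_iint k F c -> iint k (fun v => (F v)%:E) = c%:E.
Proof.
elim: k F c => [|k IH] F c /=; first by move->.
move=> [g [_ _ hg <-]]; apply: eq_integral => x _.
exact: (IH _ _ (hg x)).
Qed.

Lemma has_iintD {R : realType} {k : nat} {F G : (nat -> R) -> R} {a b : R} :
  has_iint k F a -> has_iint k G b -> has_iint k (fun v => F v + G v) (a + b).
Proof.
elim: k F G a b => [|k IH] F G a b /=; first by move=> -> ->.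
move=> [f [mf f0 Ff fa]] [g [mg g0 Gg gb]].
exists (fun x => f x + g x); split.
- exact: measurable_funD.
- by move=> x; rewrite addr_ge0.
- by move=> x; exact: (IH _ _ _ _ (Ff x) (Gg x)).
- under eq_integral do rewrite EFinD.
  rewrite ge0_integralD//= ?fa ?gb ?EFinD//.
  + by move=> x _; rewrite lee_fin.
  + exact/measurable_EFinP.
  + by move=> x _; rewrite lee_fin.
  + exact/measurable_EFinP.
Qed.

Lemma has_iintZ {R : realType} {k : nat} {F : (nat -> R) -> R} {a c : R} :
  0 <= a -> has_iint k F c -> has_iint k (fun v => a * F v) (a * c).
Proof.
move=> a0; elim: k F c => [|k IH] F c /=; first by move=> ->.
move=> [f [mf f0 Ff fa]]; exists (fun x => a * f x); split.
- exact: measurable_funM.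
- by move=> x; rewrite mulr_ge0.
- by move=> x; exact: (IH _ _ (Ff x)).
- under eq_integral do rewrite EFinM.
  rewrite ge0_integralZl//= ?fa//.
  + exact/measurable_EFinP.
  + by move=> x _; rewrite lee_fin.
Qed.

Lemma has_iint0 {R : realType} (k : nat) : has_iint k (fun _ : nat -> R => 0) (0 : R).
Proof.
elim: k => [//|k IH] /=; exists (fun _ => 0); split => //.
exact: integral0.
Qed.

Lemma has_iint_sum {R : realType} {k : nat} {I : eqType} (r : seq I)
    (F : I -> (nat -> R) -> R) (c : I -> R) :
  (forall i, i \in r -> has_iint k (F i) (c i)) ->
  has_iint k (fun v => \sum_(i <- r) F i v) (\sum_(i <- r) c i).
Proof.
elim: r => [|i r IH] h.
  by rewrite big_nil; under eq_fun do rewrite big_nil; exact: has_iint0.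
rewrite big_cons; under eq_fun do rewrite big_cons.
apply: has_iintD; first by apply: h; rewrite inE eqxx.
by apply: IH => j jr; apply: h; rewrite inE jr orbT.
Qed.

(** * Gaussian integrals in one and several variables *)

Lemma integral_gauss1 {R : realType} (s b : R) : 0 < s ->
  (\int[@lebesgue_measure R]_x (expR (- (s * (x - b) ^+ 2) / 2))%:E
   = (Num.sqrt (2 * pi) / Num.sqrt s)%:E)%E.
Proof.
move=> s0; have ss0 : 0 < Num.sqrt s by rewrite sqrtr_gt0.
have sN0 : (Num.sqrt s)^-1 != 0 by rewrite gt_eqF// invr_gt0.
have E x : expR (- (s * (x - b) ^+ 2) / 2) =
    (Num.sqrt (2 * pi) / Num.sqrt s) * normal_pdf b (Num.sqrt s)^-1 x :> R.
  rewrite normal_pdfE// /normal_peak /normal_fun exprVn sqr_sqrtr ?ltW//.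
  have -> : Num.sqrt (s^-1 * pi *+ 2) = Num.sqrt (2 * pi) / Num.sqrt s.
    rewrite -mulrnAr mulr_natl mulrC sqrtrM ?sqrtrV ?ltW//.
    by rewrite mulrn_wgt0// pi_gt0.
  rewrite mulVKf; last first.
    by rewrite gt_eqF// divr_gt0// sqrtr_gt0 mulr_gt0// pi_gt0.
  congr expR; field; by rewrite gt_eqF.
under eq_integral do rewrite E EFinM.
rewrite ge0_integralZl//=.
- by rewrite integral_normal_pdf mule1.
- by apply/measurable_EFinP; exact: measurable_normal_pdf.
- by move=> x _; rewrite lee_fin normal_pdf_ge0.
Qed.

Definition posdef (R : realType) (m : nat) (A : 'M[R]_m) : Prop :=
  A^T = A /\ forall x : 'cV_m, x != 0 -> 0 < (x^T *m A *m x) 0 0.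

Lemma dotmxC {R : realType} {n : nat} (u v : 'cV[R]_n) : u^T *m v = v^T *m u.
Proof.
rewrite -[RHS]trmxK trmx_mul trmxK.
by apply/matrixP => i j; rewrite [RHS]mxE !ord1.
Qed.

(** Induction on the dimension: the last coordinate is the outermost variable of [iint], and
    completing the square splits it off through its Schur complement. Positivity of the determinant
    is carried along because the inductive step inverts the upper left block. The separate equation
    [m = k] lets [k.+1] be read as [k + 1], the shape block matrices require. *)
Lemma has_iint_gauss_posdef {R : realType} {k m : nat} (A : 'M[R]_m) :
  m = k -> posdef A -> 0 < \det A /\ forall b : 'cV_m,
  has_iint k
    (fun v => expR (- ((\col_(i < m) v i - b)^T *m A *m (\col_(i < m) v i - b)) 0 0 / 2))
    (Num.sqrt (2 * pi) ^+ k / Num.sqrt (\det A)).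
Proof.
elim: k m A => [|k IH] m A.
  move=> m0; subst m => _; rewrite det_mx00 ltr01; split => // b /=.
  by rewrite [X in X^T]flatmx0 trmx0 !mul0mx mxE oppr0 mul0r expR0 sqrtr1 expr0 divr1.
move=> e; have {}e : m = (k + 1)%N by rewrite addn1.
subst m => -[symA posA].
set A' := ulsubmx A; set a := ursubmx A; set al := A (rshift k ord0) (rshift k ord0).
have EA : A = block_mx A' a a^T al%:M.
  rewrite -{1}[A]submxK; congr block_mx.
    by rewrite /a trmx_ursub symA.
  apply/matrixP => i j; rewrite !ord1 [in RHS]mxE eqxx !mxE//.
have symA' : A'^T = A' by rewrite /A' trmx_ulsub symA.
have quadE (z : 'cV_k) (y : R) : (col_mx z y%:M)^T *m A *m col_mx z y%:M =
    z^T *m A' *m z + (2 * y) *: (z^T *m a) + (al * y ^+ 2)%:M.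
  rewrite EA tr_col_mx mul_row_block mul_row_col !mulmxDl.
  rewrite tr_scalar_mx mul_scalar_mx mul_mx_scalar mul_scalar_mx -!addrA; congr (_ + _).
  have -> : y *: a^T *m z = y *: (z^T *m a).
    by rewrite -scalemxAl dotmxC.
  rewrite addrA -scalerDl; congr (_ *: _ + _); first by ring.
  by rewrite mul_mx_scalar !scale_scalar_mx; congr (_%:M); ring.
have posA' (x : 'cV_k) : x != 0 -> 0 < (x^T *m A' *m x) 0 0.
  move=> x0; have := posA (col_mx x (0 : R)%:M).
  rewrite quadE mulr0 scale0r addr0 expr0n/= mulr0 raddf0 addr0; apply.
  apply: contraNneq x0. by rewrite -col_mx0 => /eq_col_mx[-> _].
have [detA' gA'] := IH _ A' erefl (conj symA' posA').
have unitA' : A' \in unitmx by rewrite unitmxE unitfE gt_eqF.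
(* Completing the square in [z]: the form at [(z, y)] becomes the form of [A'] at [z + y w] plus
   [s y^2], where [s] is the Schur complement of [A']. *)
pose w := invmx A' *m a.
have Aw : A' *m w = a by rewrite mulKVmx.
have wA : w^T *m A' = a^T by rewrite -symA' -trmx_mul Aw.
pose s := al - (a^T *m w) 0 0.
have quadE2 (z : 'cV_k) (y : R) : ((col_mx z y%:M)^T *m A *m col_mx z y%:M) 0 0 =
    ((z + y *: w)^T *m A' *m (z + y *: w)) 0 0 + s * y ^+ 2.
  have -> : (z + y *: w)^T *m A' *m (z + y *: w) =
      z^T *m A' *m z + (2 * y) *: (z^T *m a) + (y ^+ 2) *: (a^T *m w).
    rewrite [(z + y *: w)^T]linearD /= [(y *: w)^T]linearZ /= mulmxDl -scalemxAl wA.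
    rewrite mulmxDl !mulmxDr -!scalemxAr -!scalemxAl -[z^T *m A' *m w]mulmxA Aw.
    rewrite (dotmxC a z) ?scalerDr scalerA -expr2 addrA -[in LHS](addrA (z^T *m A' *m z)).
    by rewrite -scalerDl; congr (_ + _ *: _ + _); ring.
  rewrite quadE /s; move: (z^T *m A' *m z) (z^T *m a) (a^T *m w) => U V W.
  by rewrite !mxE eqxx mulr1n; ring.
have s0 : 0 < s.
  (* At [z = - w], [y = 1] the first square vanishes and the form of [A] equals [s]. *)
  have := posA (col_mx (- w) 1%:M); rewrite quadE2.
  have -> : - w + 1 *: w = 0 :> 'cV[R]_k by rewrite scale1r addNr.
  rewrite mulmx0 [(0 : 'M[R]_1) 0 0]mxE add0r expr1n mulr1; apply.
  apply/negP => /eqP; rewrite -col_mx0 => /eq_col_mx[_] /matrixP /(_ 0 0).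
  by rewrite !mxE eqxx => /eqP; rewrite oner_eq0.
have detE : \det A = s * \det A'.
  have -> : A = block_mx 1%:M 0 w^T 1%:M *m block_mx A' a 0 s%:M.
    rewrite mulmx_block !mul1mx !mul0mx !addr0 EA wA (dotmxC w a); congr block_mx.
    by apply/matrixP => i j; rewrite !ord1 /s !mxE eqxx !mulr1n addrC subrK.
  by rewrite det_mulmx det_lblock det_ublock !det1 !mul1r det_scalar1 mulrC.
split=> [|b]; first by rewrite detE mulr_gt0.
rewrite /=.
exists (fun x => expR (- (s * (x - b (rshift k 0) 0) ^+ 2) / 2) *
          (Num.sqrt (2 * pi) ^+ k / Num.sqrt (\det A'))); split.
- apply: measurable_funM => //=; apply: measurableT_comp => //=.
  apply: measurable_funM => //=; apply: measurableT_comp => //=.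
  apply: measurable_funM => //=; apply: measurable_funX => //=.
  exact: measurable_funB.
- by move=> x; rewrite mulr_ge0 ?expR_ge0// divr_ge0// ?exprn_ge0.
(* For fixed last coordinate [x], the inner integral is Gaussian with matrix [A'] and a centre
   shifted along [w]. *)
- move=> x; have := has_iintZ (expR_ge0 _) (gA' (usubmx b - (x - b (rshift k 0) 0) *: w)).
  move=> /(_ (- (s * (x - b (rshift k 0) 0) ^+ 2) / 2)).
  congr has_iint; apply/funext => v /=; rewrite -expRD.
  have -> : \col_(i < k + 1) (if (i == k :> nat) then x else v i) - b =
     col_mx (\col_(i < k) v i - usubmx b) (x - b (rshift k 0) 0)%:M.
    apply/matrixP => i j; rewrite ord1 mxE [RHS]mxE; case: splitP => i' ei.
      rewrite !mxE ei ltn_eqF//; congr (_ - b _ _); exact: val_inj.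
    rewrite !mxE ei !ord1 addn0 eqxx mulr1n; congr (_ - b _ _).
    by apply: val_inj; rewrite /= ei ord1.
  rewrite quadE2 opprB addrA [X in (X *m _ *m _)](_ : _ =
    (\col_(i < k) v i - usubmx b + (x - b (rshift k 0) 0) *: w)^T); last by rewrite addrAC.
  rewrite addrAC; congr expR; lra.
- under eq_integral do rewrite mulrC EFinM.
  rewrite ge0_integralZl//=.
  + rewrite integral_gauss1// -EFinM; congr _%:E.
    rewrite detE (sqrtrM _ (ltW s0)) exprS; field.
    by rewrite !gt_eqF ?sqrtr_gt0.
  + apply/measurable_EFinP; apply: measurableT_comp => //=.
    apply: measurable_funM => //=; apply: measurableT_comp => //=.
    apply: measurable_funM => //=; apply: measurable_funX => //=.
    exact: measurable_funB.
Qed.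

(** * Euclidean norm and orthogonal projections *)

Lemma sqnormE {R : realType} {n : nat} (v : 'cV[R]_n) : sqnorm v = (v^T *m v) 0 0.
Proof. by rewrite mxE; apply: eq_bigr => i _; rewrite mxE -expr2. Qed.

Lemma sqnorm_ge0 {R : realType} {n : nat} (v : 'cV[R]_n) : 0 <= sqnorm v.
Proof. by apply: sumr_ge0 => i _; exact: sqr_ge0. Qed.

Lemma sqnorm_gt0 {R : realType} {n : nat} (v : 'cV[R]_n) : v != 0 -> 0 < sqnorm v.
Proof.
move=> v0; rewrite lt0r sqnorm_ge0 andbT; apply: contraNneq v0 => /eqP.
rewrite psumr_eq0 => [/allP h|i _]; last exact: sqr_ge0.
apply/eqP/matrixP => i j; rewrite ord1 mxE; apply/eqP.
by rewrite -sqrf_eq0; apply: h; rewrite mem_index_enum.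
Qed.

Lemma sqnormD {R : realType} {n : nat} (u v : 'cV[R]_n) :
  sqnorm (u + v) = sqnorm u + 2 * (u^T *m v) 0 0 + sqnorm v.
Proof.
rewrite !sqnormE [(u + v)^T]linearD /= mulmxDl !mulmxDr (dotmxC v u).
move: (u^T *m u) (u^T *m v) (v^T *m v) => A B C; rewrite !mxE; ring.
Qed.

Lemma sqnormZ {R : realType} {n : nat} (a : R) (v : 'cV[R]_n) :
  sqnorm (a *: v) = a ^+ 2 * sqnorm v.
Proof. by rewrite mulr_sumr; apply: eq_bigr => i _; rewrite mxE exprMn. Qed.

Lemma sqnormB {R : realType} {n : nat} (u v : 'cV[R]_n) :
  sqnorm (u - v) = sqnorm u - 2 * (u^T *m v) 0 0 + sqnorm v.
Proof.
rewrite sqnormD mulmxN [(- (u^T *m v)) 0 0]mxE mulrN; congr (_ + _).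
by rewrite -scaleN1r sqnormZ sqrrN expr1n mul1r.
Qed.

Lemma sqnorm_tr_proj {R : realType} {n t : nat} (Q : 'M[R]_(n, t)) (v : 'cV_n) :
  sqnorm (Q^T *m v) = (v^T *m (Q *m Q^T) *m v) 0 0.
Proof. by rewrite sqnormE trmx_mul trmxK !mulmxA. Qed.

(** Pythagoras: the last bracket is the squared distance from [a] to the column space of [Q], and
    only the first term depends on [z]. *)
Lemma sqnorm_isometryB {R : realType} {n t : nat} (Q : 'M[R]_(n, t)) (z : 'cV_t) (a : 'cV_n) :
  Q^T *m Q = 1%:M ->
  sqnorm (Q *m z - a) = sqnorm (z - Q^T *m a) + (sqnorm a - sqnorm (Q^T *m a)).
Proof.
move=> QQ; rewrite !sqnormB (sqnormE (Q *m z)) trmx_mul mulmxA -[z^T *m Q^T *m Q]mulmxA QQ mulmx1 -sqnormE.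
by rewrite [z^T *m (Q^T *m a)]mulmxA; ring.
Qed.

Lemma sqnorm_tr_le {R : realType} {n t : nat} (Q : 'M[R]_(n, t)) (a : 'cV_n) :
  Q^T *m Q = 1%:M -> sqnorm (Q^T *m a) <= sqnorm a.
Proof.
move=> QQ; rewrite -subr_ge0.
have := sqnorm_isometryB (Q^T *m a) a QQ; rewrite subrr.
have -> : sqnorm (0 : 'cV[R]_t) = 0.
  by rewrite /sqnorm big1// => i _; rewrite mxE expr0n.
by rewrite add0r => <-; exact: sqnorm_ge0.
Qed.

(** Sylvester's determinant identity: the block matrix with rows [(1, B)] and [(C, 1)] is factored
    in two ways. *)
Lemma det_1sub_mulmxC {R : comNzRingType} {m n : nat} (B : 'M[R]_(m, n)) (C : 'M[R]_(n, m)) :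
  \det (1%:M - B *m C) = \det (1%:M - C *m B).
Proof.
have E : block_mx 1%:M B 0 1%:M *m block_mx (1%:M - B *m C) 0 C 1%:M =
         block_mx 1%:M 0 C 1%:M *m block_mx 1%:M B 0 (1%:M - C *m B).
  by rewrite !mulmx_block !mul1mx !mul0mx !mulmx1 ?mulmx0 !addr0 !add0r subrK addrC subrK.
have := congr1 determinant E.
by rewrite !det_mulmx !det_lblock !det_ublock !det1 !mul1r !mulr1.
Qed.

Lemma posdef_1sub_proj {R : realType} {n t : nat} (c : R) (Q : 'M[R]_(n, t)) :
  0 <= c -> c < 1 -> Q^T *m Q = 1%:M -> posdef (1%:M - c *: (Q *m Q^T)).
Proof.
move=> c0 c1 QQ; split.
  by rewrite linearB /= linearZ /= trmx_mul trmxK trmx1.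
move=> x x0; rewrite mulmxBr mulmx1 mulmxBl -scalemxAr -scalemxAl.
rewrite mxE [X in _ + X]mxE [X in - X]mxE -sqnormE -sqnorm_tr_proj.
have := sqnorm_tr_le x QQ; have := sqnorm_gt0 x0; nra.
Qed.

(** Sylvester's identity replaces the projection by [Q^T *m Q = 1], leaving a scalar matrix of size
    [t]. *)
Lemma det_1sub_proj {R : realType} {n t : nat} (c : R) (Q : 'M[R]_(n, t)) :
  Q^T *m Q = 1%:M -> \det (1%:M - c *: (Q *m Q^T)) = (1 - c) ^+ t.
Proof.
move=> QQ; rewrite scalemxAl det_1sub_mulmxC -scalemxAr QQ.
by rewrite -[c *: _]/(c *: 1%:M) scalemx1 -raddfB /= det_scalar.
Qed.

Lemma posdef_scalar {R : realType} {n : nat} (s : R) : 0 < s -> posdef (s%:M : 'M[R]_n).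
Proof.
move=> s0; split; first by rewrite tr_scalar_mx.
move=> x x0; rewrite mul_mx_scalar -scalemxAl mxE -sqnormE mulr_gt0//.
exact: sqnorm_gt0.
Qed.

(** * Orthonormal bases and the number of model spaces *)

(** All rows but the first are orthonormalized by induction; the first then contributes its
    normalized residual, which is nonzero because the rows are independent. *)
Lemma gram_schmidt {R : realType} {k n : nat} (B : 'M[R]_(k, n)) : row_free B ->
  exists W : 'M[R]_(k, n), W *m W^T = 1%:M /\ (W == B)%MS.
Proof.
elim: k B => [|k IH] B freeB.
  by exists B; rewrite submx_refl; split => //; apply/matrixP => -[].
move: B freeB; rewrite -[k.+1]/(1 + k)%N => B freeB.
pose b := usubmx B; pose B' := dsubmx B.
have EB : B = col_mx b B' by rewrite vsubmxK.
have rB : \rank B = (1 + k)%N by apply/eqP.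
have subB : (\rank B <= \rank b + \rank B')%N.
  by rewrite EB -addsmxE; exact: mxrank_adds_leqif.
have freeB' : row_free B'.
  rewrite /row_free eqn_leq rank_leq_row /=.
  rewrite -(leq_add2l 1) -rB (leq_trans subB)// leq_add2r; exact: rank_leq_row.
have [W [OO /andP[OB BO]]] := IH _ freeB'.
pose w := b - b *m W^T *m W.
have w0 : w != 0.
  apply/eqP => /eqP; rewrite subr_eq0 => /eqP bE.
  have bB : (b <= B')%MS by rewrite bE (submx_trans _ OB)// submxMl.
  have : (\rank B <= \rank B')%N by apply: mxrankS; rewrite EB -addsmxE addsmx_sub bB submx_refl.
  by rewrite rB (eqP freeB') ltnn.
have wO : w *m W^T = 0 by rewrite mulmxBl -!mulmxA OO mulmx1 subrr.
pose r := sqnorm w^T.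
have r0 : 0 < r by apply: sqnorm_gt0; rewrite trmx_eq0.
have ww : w *m w^T = r%:M.
  by apply/matrixP => i j; rewrite !ord1 [RHS]mxE eqxx /r sqnormE trmxK.
pose e := (Num.sqrt r)^-1 *: w.
have sr0 : Num.sqrt r != 0 by rewrite gt_eqF// sqrtr_gt0.
exists (col_mx e W); split.
  have eO : e *m W^T = 0 by rewrite -scalemxAl wO scaler0.
  have Oe : W *m e^T = 0 by rewrite -[W]trmxK -trmx_mul eO trmx0.
  rewrite tr_col_mx mul_col_row OO eO Oe /e linearZ /= -scalemxAl -scalemxAr ww scalerA scale_scalar_mx.
  have -> : (Num.sqrt r)^-1 / Num.sqrt r * r = 1.
    by rewrite -{3}(sqr_sqrtr (ltW r0)); field.
  by rewrite -scalar_mx_block.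
have bwO : b = Num.sqrt r *: e + b *m W^T *m W.
  by rewrite /e scalerA divff// scale1r /w subrK.
rewrite EB -!addsmxE; apply/andP; split; rewrite addsmx_sub.
  apply/andP; split; last exact: submx_trans OB (addsmxSr _ _).
  apply: scalemx_sub; apply: addmx_sub; first exact: addsmxSl.
  by rewrite eqmx_opp; apply: submx_trans (addsmxSr _ _); apply: submx_trans OB; exact: submxMl.
apply/andP; split; last exact: submx_trans BO (addsmxSr _ _).
rewrite {1}bwO; apply: addmx_sub; first by apply: scalemx_sub; exact: addsmxSl.
by apply: submx_trans (addsmxSr _ _); exact: submxMl.
Qed.

(** [onb] is a choice with default [0]; Gram-Schmidt shows that the default never occurs when the
    number of columns is the rank. *)
Lemma onbP {R : realType} {n : nat} (V : 'M[R]_n) : is_onb V (onb (\rank V) V).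
Proof.
have [W [OO OV]] := gram_schmidt (row_base_free V).
rewrite /onb; case: xgetP => [_ -> //|/(_ W^T)] []; split; rewrite trmxK//.
by apply/eqmxP; apply: eqmx_trans (eq_row_base V); exact/eqmxP.
Qed.

(** A model space of dimension [t] is spanned by [t] columns of [X], so the [p ^ t] maps from [t]
    positions to column indices reach all of them. *)
Lemma size_subspaces_dim {R : realType} {n p : nat} (X : 'M[R]_(n, p)) (t : nat) :
  (size (subspaces_dim X t) <= p ^ t)%N.
Proof.
pose g (f : {ffun 'I_t -> 'I_p}) : 'M[R]_n := (<< rowsub f X^T >>)%MS.
have -> : (p ^ t)%N = size [seq g f | f : {ffun 'I_t -> 'I_p}].
  by rewrite size_map -cardE card_ffun !card_ord.
apply: uniq_leq_size; first by rewrite filter_uniq// undup_uniq.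
move=> V; rewrite mem_filter mem_undup => /andP[/eqP rV /mapP[S _ EV]].
have rM : \rank (subsp_mx X S) = t by rewrite -rV EV genmxE.
clear rV; subst t; set M := subsp_mx X S.
apply/mapP; exists (maxrankfun M); first by rewrite mem_enum.
rewrite EV /subsp /g; apply: eq_genmx.
suff -> : rowsub (maxrankfun M) X^T = rowsub (maxrankfun M) M by apply: eqmx_sym; exact: eq_maxrowsub.
(* Rows of [M] with index outside [S] are zero, so a free family of rows uses only indices in [S],
   where [M] agrees with [X^T]. *)
have fr := maxrowsub_free M.
apply/matrixP => i j; rewrite !mxE; case: ifP => // /negbT iS.
have : row i (rowsub (maxrankfun M) M) = 0.
  by apply/rowP => l; rewrite !mxE (negPf iS).
move=> ri0; move: fr => /row_freeP[C] /(congr1 (row i)).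
rewrite row_mul ri0 mul0mx => /rowP/(_ i); rewrite !mxE eqxx => /eqP.
by rewrite eq_sym oner_eq0.
Qed.

(** * Likelihood integrals over a model space *)

Lemma has_iint_isometry {R : realType} {n t : nat} (Q : 'M[R]_(n, t)) (s : R) (a : 'cV_n) :
  Q^T *m Q = 1%:M -> 0 < s ->
  has_iint t (fun v => expR (- (s * sqnorm (Q *m (\col_(i < t) v i) - a)) / 2))
    (expR (- (s * (sqnorm a - sqnorm (Q^T *m a))) / 2) *
       (Num.sqrt (2 * pi) ^+ t / Num.sqrt (s ^+ t))).
Proof.
move=> QQ s0; have [_ /(_ (Q^T *m a)) g] := has_iint_gauss_posdef erefl (@posdef_scalar R t s s0).
rewrite det_scalar in g.
have := has_iintZ (expR_ge0 (- (s * (sqnorm a - sqnorm (Q^T *m a))) / 2)) g.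
congr has_iint; apply/funext => v /=; rewrite -expRD sqnorm_isometryB//.
have quadE (x : 'cV[R]_t) : (x^T *m s%:M *m x) 0 0 = s * sqnorm x.
  by rewrite mul_mx_scalar -scalemxAl mxE sqnormE.
by rewrite quadE; congr expR; ring.
Qed.

(** Taking [fine] loses nothing: the integral is dominated by the one over the whole space [V], an
    explicit finite Gaussian integral. *)
Definition likelihood_mass {R : realType} {n : nat} (B : set 'cV[R]_n) (V : 'M[R]_n) (Y : 'cV[R]_n) : R :=
  fine (int_sub V (fun g => ((\1_B g : R) * expR (- sqnorm (Y - g) / 2))%:E)).

Lemma sqnormBC {R : realType} {n : nat} (u v : 'cV[R]_n) : sqnorm (u - v) = sqnorm (v - u).
Proof. by rewrite -opprB -scaleN1r sqnormZ sqrrN expr1n mul1r. Qed.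

Lemma int_sub_setT {R : realType} {n : nat} (V : 'M[R]_n) (Y : 'cV[R]_n) (t := \rank V) :
  int_sub V (fun g => ((\1_[set: 'cV[R]_n] g : R) * expR (- sqnorm (Y - g) / 2))%:E) =
  (expR (- (sqnorm Y - sqnorm ((onb t V)^T *m Y)) / 2) * Num.sqrt (2 * pi) ^+ t)%:E.
Proof.
have [QQ _] := onbP V; have := has_iint_isometry Y QQ ltr01.
rewrite mul1r expr1n sqrtr1 divr1 => /has_iintE <-.
rewrite /int_sub /int_Rn; congr iint; apply/funext => v.
by rewrite indicE in_setT mul1r mul1r sqnormBC.
Qed.

Lemma int_sub_ge0 {R : realType} {n : nat} (B : set 'cV[R]_n) (V : 'M[R]_n) (Y : 'cV[R]_n) :
  (0 <= int_sub V (fun g => ((\1_B g : R) * expR (- sqnorm (Y - g) / 2))%:E))%E.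
Proof. by apply: iint_ge0 => v; rewrite lee_fin mulr_ge0 ?expR_ge0. Qed.

Lemma le_int_sub_setT {R : realType} {n : nat} (B : set 'cV[R]_n) (V : 'M[R]_n) (Y : 'cV[R]_n) :
  (int_sub V (fun g => ((\1_B g : R) * expR (- sqnorm (Y - g) / 2))%:E) <=
   int_sub V (fun g => ((\1_[set: 'cV[R]_n] g : R) * expR (- sqnorm (Y - g) / 2))%:E))%E.
Proof.
apply: le_iint => v; rewrite lee_fin ?mulr_ge0 ?expR_ge0//.
by rewrite ler_wpM2r ?expR_ge0// !indicE in_setT; case: (_ \in _).
Qed.

Lemma likelihood_massE {R : realType} {n : nat} (B : set 'cV[R]_n) (V : 'M[R]_n) (Y : 'cV[R]_n) :
  (likelihood_mass B V Y)%:E =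
  int_sub V (fun g => ((\1_B g : R) * expR (- sqnorm (Y - g) / 2))%:E).
Proof.
rewrite fineK// ge0_fin_numE ?int_sub_ge0//.
by apply: le_lt_trans (le_int_sub_setT _ _ _) _; rewrite int_sub_setT ltry.
Qed.

Lemma likelihood_mass_ge0 {R : realType} {n : nat} (B : set 'cV[R]_n) (V : 'M[R]_n) (Y : 'cV[R]_n) :
  0 <= likelihood_mass B V Y.
Proof. by rewrite -lee_fin likelihood_massE int_sub_ge0. Qed.

Lemma likelihood_mass_setT {R : realType} {n : nat} (V : 'M[R]_n) (Y : 'cV[R]_n) (t := \rank V) :
  likelihood_mass [set: 'cV[R]_n] V Y =
  expR (- (sqnorm Y - sqnorm ((onb t V)^T *m Y)) / 2) * Num.sqrt (2 * pi) ^+ t.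
Proof. by rewrite /likelihood_mass int_sub_setT. Qed.

Lemma likelihood_mass_le_setT {R : realType} {n : nat} (B : set 'cV[R]_n) (V : 'M[R]_n) (Y : 'cV[R]_n) :
  likelihood_mass B V Y <= likelihood_mass [set: 'cV[R]_n] V Y.
Proof. by rewrite -lee_fin !likelihood_massE le_int_sub_setT. Qed.

(* Chernoff bound: [1_{r < |h|^2} <= exp ((|h|^2 - r) / 8)], then complete the
   square in [h = g - th]. *)
Lemma likelihood_mass_far_le {R : realType} {n : nat} (r : R) (V : 'M[R]_n) (th e : 'cV[R]_n) (t := \rank V)
    (a := th + (4 / 3) *: e) :
  likelihood_mass [set g | r < sqnorm (g - th)] V (th + e) <=
  expR (sqnorm e / 6 - r / 8) *
   (expR (- (3 / 4 * (sqnorm a - sqnorm ((onb t V)^T *m a))) / 2) *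
     (Num.sqrt (2 * pi) ^+ t / Num.sqrt ((3 / 4) ^+ t))).
Proof.
have [QQ _] := onbP V; have s0 : 0 < 3 / 4 :> R by lra.
rewrite -lee_fin likelihood_massE -(has_iintE (has_iintZ (expR_ge0 _) (has_iint_isometry a QQ s0))).
apply: le_iint => v; rewrite lee_fin ?mulr_ge0 ?expR_ge0//.
set g := onb _ _ *m _.
have [h [gE gaE yE]] : exists h, [/\ g - th = h, g - a = h - (4 / 3) *: e & th + e - g = e - h].
  by exists (g - th); rewrite /a opprD opprB addrA [th + e]addrC addrA.
rewrite gaE yE -expRD; apply: (@le_trans _ _ (expR ((sqnorm h - r) / 8) * expR (- sqnorm (e - h) / 2))).
  rewrite ler_wpM2r ?expR_ge0// indicE; case: (boolP (_ \in _)) => [|_]; last exact: expR_ge0.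
  rewrite in_setE /= gE => rh.
  by rewrite -[true%:R]expR0 ler_expR; lra.
(* The constants come from [|h|^2 / 8 - |e - h|^2 / 2 = |e|^2 / 6 - (3/8) |h - (4/3) e|^2]. *)
have dotE : (h^T *m ((4 / 3) *: e)) 0 0 = 4 / 3 * (h^T *m e) 0 0 by rewrite -scalemxAr mxE.
by rewrite -expRD ler_expR !sqnormB sqnormZ dotE (dotmxC e h); lra.
Qed.

(** * Pointwise bound on the posterior *)

Lemma post_numE {R : realType} (d : R) {n p : nat} (X : 'M[R]_(n, p)) (B : set 'cV[R]_n) (Y : 'cV[R]_n) :
  post_num d X B Y = (\sum_(t < n.+1) \sum_(V <- subspaces_dim X t)
     pi_n d n p t / (size (subspaces_dim X t))%:R * likelihood_mass B V Y)%:E.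
Proof.
rewrite /post_num -sumEFin; apply: eq_bigr => t _.
rewrite -mulr_sumr [RHS]EFinM -sumEFin; congr (_ * _)%E; apply: eq_bigr => V _.
by rewrite likelihood_massE.
Qed.

Lemma pi_n_gt0 {R : realType} (d : R) (n p t : nat) : 0 < pi_n d n p t.
Proof.
apply: divr_gt0; first exact: expR_gt0.
rewrite big_ord_recl ltr_pwDl ?expR_gt0// sumr_ge0// => i _; exact: expR_ge0.
Qed.

(** Each ratio lies in [[0, 1]], where a number is at most its square root. *)
Lemma le_sum_sqrt {R : realType} {I : eqType} (r : seq I) (a : I -> R) (D : R) :
  0 < D -> (forall i, i \in r -> 0 <= a i <= D) ->
  (\sum_(i <- r) a i) / D <= \sum_(i <- r) Num.sqrt (a i / D).
Proof.
move=> D0 h; rewrite mulr_suml !big_seq; apply: ler_sum => i /h/andP[a0 aD].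
have b0 : 0 <= a i / D by rewrite divr_ge0// ltW.
have b1 : Num.sqrt (a i / D) <= 1.
  by rewrite -[leRHS]sqrtr1 ler_wsqrtr// ler_pdivrMr// mul1r.
rewrite -{1}(sqr_sqrtr b0) expr2 ler_piMr//; exact: sqrtr_ge0.
Qed.

Lemma le_term_sum {R : realType} {I : eqType} (r : seq I) (F : I -> R) (i : I) :
  (forall j, 0 <= F j) -> i \in r -> F i <= \sum_(j <- r) F j.
Proof. by move=> F0 ir; rewrite (big_rem i ir) /= lerDl sumr_ge0. Qed.

(** As [th] lies in [V], the distance from [th + e] to [V] is at most [|e|]. *)
Lemma likelihood_mass_near_ge {R : realType} {n : nat} (V : 'M[R]_n) (th e : 'cV[R]_n) :
  (th^T <= V)%MS ->
  expR (- sqnorm e / 2) * Num.sqrt (2 * pi) ^+ \rank V <=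
  likelihood_mass [set: 'cV[R]_n] V (th + e).
Proof.
move=> thV; have [QQ /andP[_ VQ]] := onbP V; rewrite likelihood_mass_setT.
rewrite ler_wpM2r ?exprn_ge0// ler_expR.
have [z thE] : exists z, th = onb (\rank V) V *m z.
  have /submxP[C CE] := submx_trans thV VQ.
  by exists C^T; rewrite -[th]trmxK CE trmx_mul trmxK.
have := sqnorm_isometryB z (th + e) QQ; rewrite -thE.
rewrite [sqnorm (th - _)]sqnormBC [th + e]addrC addrK.
have := sqnorm_ge0 (z - (onb (\rank V) V)^T *m (e + th)); lra.
Qed.

(* The left side is the exponent of the square root of the bound on a posterior
   ratio, times the Gaussian density. *)
Lemma tilted_exponent_le {R : realType} {n t : nat} (Q : 'M[R]_(n, t)) (th e : 'cV[R]_n)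
    (a := th + (4 / 3) *: e) (x := e + 2^-1 *: (th - Q *m (Q^T *m th))) :
  Q^T *m Q = 1%:M ->
  (2 / 3 * sqnorm e - 3 / 8 * (sqnorm a - sqnorm (Q^T *m a))) / 2 + - sqnorm e / 2 <=
  - (x^T *m (1%:M - (2 / 3) *: (Q *m Q^T)) *m x) 0 0 / 2.
Proof.
move=> QQ; set u := th - Q *m (Q^T *m th) in x *.
have quadE : (x^T *m (1%:M - (2 / 3) *: (Q *m Q^T)) *m x) 0 0 =
    sqnorm x - 2 / 3 * sqnorm (Q^T *m x).
  rewrite mulmxBr mulmx1 mulmxBl -scalemxAr -scalemxAl.
  by rewrite mxE [X in _ + X]mxE [X in - X]mxE -sqnormE -sqnorm_tr_proj.
have Qu : Q^T *m u = 0 by rewrite mulmxBr (mulmxA Q^T Q) QQ mul1mx subrr.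
have Qx : Q^T *m x = Q^T *m e by rewrite mulmxDr -scalemxAr Qu scaler0 addr0.
have uE : sqnorm u = sqnorm th - sqnorm (Q^T *m th).
  rewrite /u sqnormBC sqnorm_isometryB// subrr sqnormE mulmx0 mxE; ring.
have ueE : (u^T *m e) 0 0 = (th^T *m e) 0 0 - ((Q^T *m th)^T *m (Q^T *m e)) 0 0.
  rewrite /u [(th - _)^T]linearB /= mulmxBl [(Q *m (Q^T *m th))^T]trmx_mul.
  by rewrite -[_ *m Q^T *m e]mulmxA mxE [X in _ + X]mxE.
have dotZ (m : nat) (c : R) (y z : 'cV[R]_m) : (y^T *m (c *: z)) 0 0 = c * (y^T *m z) 0 0.
  by rewrite -scalemxAr mxE.
rewrite quadE Qx /x /a mulmxDr -scalemxAr !sqnormD !sqnormZ !dotZ (dotmxC e u) uE ueE.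
(* The shift by [u / 2] in [x] accounts for the cross term between [u] and [e]; the two sides then
   differ by [|u|^2 / 16]. *)
have := sqnorm_ge0 u; rewrite uE; lra.
Qed.

(** The factor of the ratio bound [R_V] that is free of the noise: [t] is the dimension of [V], [u]
    that of [V^0], and [r] the squared radius. *)
Definition term_weight (R : realType) (d : R) (n p : nat) (X : 'M[R]_(n, p)) (r : R) (u t : nat) : R :=
  (pi_n d n p t / (size (subspaces_dim X t))%:R) /
  (pi_n d n p u / (size (subspaces_dim X u))%:R) *
  (expR (- r / 8) *
   (Num.sqrt (2 * pi) ^+ t / Num.sqrt (2 * pi) ^+ u / Num.sqrt ((3 / 4) ^+ t))).

Lemma sqrt_expR {R : realType} (x : R) : Num.sqrt (expR x) = expR (x / 2).
Proof.
have -> : expR x = expR (x / 2) ^+ 2 by rewrite expr2 -expRD; congr expR; lra.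
by rewrite sqrtr_sqr ger0_norm ?expR_ge0.
Qed.

Lemma term_weight_ge0 {R : realType} (d : R) {n p : nat} (X : 'M[R]_(n, p)) (r : R) (u t : nat) :
  0 <= term_weight d X r u t.
Proof.
have pi0 v : 0 <= pi_n d n p v by rewrite ltW ?pi_n_gt0.
apply: mulr_ge0; first by apply: divr_ge0; apply: divr_ge0.
by apply: mulr_ge0; rewrite ?expR_ge0.
Qed.

Lemma tr_mulmx_subsp {R : realType} {n p : nat} (X : 'M[R]_(n, p)) (beta : 'cV_p) :
  ((X *m beta)^T <= subsp X (supp beta))%MS.
Proof.
rewrite genmxE; apply/submxP; exists beta^T; apply/rowP => i.
rewrite !mxE; apply: eq_bigr => j _; rewrite !mxE mulrC inE.
by case: eqP => [->|]; rewrite ?mul0r.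
Qed.

Lemma posterior_le {R : realType} (d : R) {n p : nat} (X : 'M[R]_(n, p)) (beta : 'cV_p)
    (r : R) (e : 'cV_n) (th := X *m beta) :
  posterior d X [set g | r < sqnorm (g - th)] (th + e) <=
  \sum_(t < n.+1) \sum_(V <- subspaces_dim X t)
     Num.sqrt (term_weight d X r (t0 X beta) t) *
     expR ((2 / 3 * sqnorm e - 3 / 8 * (sqnorm (th + (4 / 3) *: e)
        - sqnorm ((onb (\rank V) V)^T *m (th + (4 / 3) *: e)))) / 2).
Proof.
set B := [set g | _]; rewrite /posterior !post_numE /=.
set w := fun t => pi_n d n p t / (size (subspaces_dim X t))%:R.
have w0 t : 0 <= w t by rewrite divr_ge0// ltW// pi_n_gt0.
set D := \sum_(t < n.+1) \sum_(V <- _) w t * likelihood_mass setT V (th + e).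
set V0 := subsp X (supp beta); set u := t0 X beta.
have un : (u < n.+1)%N by rewrite ltnS /u /t0 rank_leq_col.
have V0in : V0 \in subspaces_dim X u.
  by rewrite mem_filter /u /t0 eqxx /= mem_undup; apply/mapP; exists (supp beta); rewrite ?mem_enum.
have leD (t : 'I_n.+1) V : V \in subspaces_dim X t ->
    w t * likelihood_mass setT V (th + e) <= D.
  move=> Vt; apply: (@le_trans _ _ (\sum_(V <- subspaces_dim X t) w t * likelihood_mass setT V (th + e))).
    by apply: (le_term_sum _ Vt) => W; rewrite mulr_ge0// likelihood_mass_ge0.
  apply: (@le_term_sum _ _ _ (fun t : 'I_n.+1 =>
    \sum_(V <- subspaces_dim X t) w t * likelihood_mass setT V (th + e))).
    by move=> j; rewrite sumr_ge0// => W _; rewrite mulr_ge0// likelihood_mass_ge0.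
  by rewrite mem_index_enum.
(* Membership of [V0] makes the count positive; division by a zero count would give weight [0]. *)
have wu : 0 < w u.
  rewrite divr_gt0 ?pi_n_gt0// ltr0n; case: (subspaces_dim X u) V0in => //.
set s := Num.sqrt (2 * pi) : R.
have s0 : 0 < s by rewrite sqrtr_gt0 mulr_gt0// pi_gt0.
set D0 := w u * (expR (- sqnorm e / 2) * s ^+ u).
have D00 : 0 < D0 by apply: mulr_gt0 => //; apply: mulr_gt0; rewrite ?expR_gt0 ?exprn_gt0.
have DD0 : D0 <= D.
  apply: le_trans (leD (Ordinal un) _ V0in); rewrite ler_wpM2l//.
  by apply: likelihood_mass_near_ge; exact: tr_mulmx_subsp.
have D_gt0 : 0 < D by apply: lt_le_trans DD0.
rewrite mulr_suml; apply: ler_sum => t _.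
(* The square root is taken with the true denominator [D], for which the ratios are at most [1]; the
   lower bound [D0] replaces it only under the root. *)
apply: le_trans (le_sum_sqrt D_gt0 _) _.
  move=> V Vt; apply/andP; split; first exact: mulr_ge0 (w0 t) (likelihood_mass_ge0 _ _ _).
  exact: le_trans (ler_wpM2l (w0 t) (likelihood_mass_le_setT _ _ _)) (leD _ _ Vt).
rewrite !big_seq; apply: ler_sum => V Vt.
have rV : \rank V = t by move: Vt; rewrite mem_filter => /andP[/eqP].
rewrite -sqrt_expR -sqrtrM ?term_weight_ge0//; apply: ler_wsqrtr.
have N0 : 0 <= w t * likelihood_mass B V (th + e) by rewrite mulr_ge0// likelihood_mass_ge0.
apply: (@le_trans _ _ (w t * likelihood_mass B V (th + e) / D0)).
  by rewrite ler_wpM2l// lef_pV2.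
rewrite ler_pdivrMr//.
apply: le_trans (ler_wpM2l (w0 t) (likelihood_mass_far_le r V th e)) _.
rewrite rV; set q := sqnorm (th + _) - _.
rewrite /term_weight -/(w t) -/(w u) -/s /D0.
set c := Num.sqrt ((3 / 4) ^+ t).
have c0 : 0 < c by rewrite sqrtr_gt0 exprn_gt0//; lra.
have -> : expR (sqnorm e / 6 - r / 8) = expR (- r / 8) * expR (sqnorm e / 6).
  by rewrite -expRD; congr expR; lra.
(* Here [2/3 = 1/6 + 1/2]: the completed square gives [1/6], the division by [D0] gives [1/2]. *)
have -> : expR (2 / 3 * sqnorm e - 3 / 8 * q) =
    expR (sqnorm e / 6) * expR (- (3 / 4 * q) / 2) / expR (- sqnorm e / 2).
  by rewrite -expRN -!expRD; congr expR; lra.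
rewrite le_eqVlt; apply/orP; left; apply/eqP; field.
by rewrite !gt_eqF ?expR_gt0 ?exprn_gt0.
Qed.

Lemma posterior_ge0 {R : realType} (d : R) {n p : nat} (X : 'M[R]_(n, p)) (B : set 'cV[R]_n)
    (Y : 'cV[R]_n) : 0 <= posterior d X B Y.
Proof.
rewrite /posterior !post_numE /=; apply: divr_ge0; apply: sumr_ge0 => t _;
  apply: sumr_ge0 => V _; apply: mulr_ge0; rewrite ?likelihood_mass_ge0//;
  by apply: divr_ge0 => //; exact/ltW/pi_n_gt0.
Qed.

(** * Expectation over the noise *)

(** The posterior times the noise density is dominated pointwise by a finite sum of Gaussians, one
    per model space, each integrated exactly through the determinant of [I - (2/3) P]. *)
Lemma expect_posterior_le {R : realType} (d : R) {n p : nat} (X : 'M[R]_(n, p)) (beta : 'cV_p) (r : R) :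
  (expect X beta (posterior d X [set g | (r < sqnorm (g - X *m beta))%R]) <=
   (\sum_(t < n.+1) (size (subspaces_dim X t))%:R *
     (Num.sqrt (term_weight d X r (t0 X beta) t) / Num.sqrt ((1 - 2 / 3) ^+ t)))%:E)%E.
Proof.
set th := X *m beta; set B := [set g | _]; set s := Num.sqrt (2 * pi) : R.
have s0 : 0 < s by rewrite sqrtr_gt0 mulr_gt0// pi_gt0.
pose A (V : 'M[R]_n) : 'M[R]_n := 1%:M - (2 / 3) *: (onb (\rank V) V *m (onb (\rank V) V)^T).
(* Minus half the component of [th] orthogonal to [V], so that [e - b V] is the vector [x] of
   [tilted_exponent_le]. *)
pose b (V : 'M[R]_n) : 'cV[R]_n := - (2^-1 *: (th - onb (\rank V) V *m ((onb (\rank V) V)^T *m th))).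
pose q (V : 'M[R]_n) (e : 'cV[R]_n) := ((e - b V)^T *m A V *m (e - b V)) 0 0.
pose k t := Num.sqrt (term_weight d X r (t0 X beta) t).
have intE t V : V \in subspaces_dim X t ->
    has_iint n (fun v => k t * s^-1 ^+ n * expR (- q V (\col_(i < n) v i) / 2))
      (k t / Num.sqrt ((1 - 2 / 3) ^+ t)).
  rewrite mem_filter => /andP[/eqP rV _]; have [QQ _] := onbP V.
  have h0 : 0 <= 2 / 3 :> R by lra.
  have h1 : 2 / 3 < 1 :> R by lra.
  have [_ /(_ (b V)) gV] := has_iint_gauss_posdef erefl (posdef_1sub_proj h0 h1 QQ).
  have k0 : 0 <= k t * s^-1 ^+ n by apply: mulr_ge0; rewrite ?sqrtr_ge0// exprn_ge0// invr_ge0 ltW.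
  rewrite det_1sub_proj// in gV.
  have -> : k t / Num.sqrt ((1 - 2 / 3) ^+ t) =
      k t * s^-1 ^+ n * (s ^+ n / Num.sqrt ((1 - 2 / 3) ^+ \rank V)).
    rewrite rV exprVn; field; rewrite expf_neq0 ?gt_eqF// sqrtr_gt0 exprn_gt0//; lra.
  exact: has_iintZ k0 gV.
have sumE : has_iint n
    (fun v => \sum_(t < n.+1) \sum_(V <- subspaces_dim X t)
       k t * s^-1 ^+ n * expR (- q V (\col_(i < n) v i) / 2))
    (\sum_(t < n.+1) (size (subspaces_dim X t))%:R * (k t / Num.sqrt ((1 - 2 / 3) ^+ t))).
  apply: has_iint_sum => t _.
  have -> : (size (subspaces_dim X t))%:R * (k t / Num.sqrt ((1 - 2 / 3) ^+ t)) =
      \sum_(V <- subspaces_dim X t) k t / Num.sqrt ((1 - 2 / 3) ^+ t).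
    by rewrite big_const_seq count_predT iter_addr addr0 mulr_natl.
  by apply: has_iint_sum => V Vt; exact: intE.
rewrite -(has_iintE sumE); apply: le_iint => v; rewrite lee_fin.
  by rewrite mulr_ge0 ?posterior_ge0// mulr_ge0 ?expR_ge0// exprn_ge0// invr_ge0.
set e := \col_(i < n) v i.
apply: le_trans (ler_wpM2r _ (posterior_le d X beta r e)) _.
  by rewrite mulr_ge0 ?expR_ge0// exprn_ge0// invr_ge0.
rewrite mulr_suml; apply: ler_sum => t _; rewrite mulr_suml; apply: ler_sum => V _.
rewrite -/(k t) /gauss_dens -/s.
rewrite mulrACA ler_wpM2l -?expRD ?ler_expR//.
  by apply: mulr_ge0; rewrite ?sqrtr_ge0// exprn_ge0// invr_ge0 ltW.
have [QQ _] := onbP V; have := tilted_exponent_le th e QQ.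
by rewrite /q /b opprK.
Qed.

(** * Summation over dimensions and the limit *)

Lemma sum_half_pow_le2 {R : realType} (n : nat) : \sum_(t < n) (2^-1 : R) ^+ t <= 2.
Proof.
have E : \sum_(t < n) (2^-1 : R) ^+ t = 2 - 2 * 2^-1 ^+ n.
  elim: n => [|n IH]; first by rewrite big_ord0 expr0; lra.
  by rewrite big_ord_recr /= IH exprS; lra.
by rewrite E gerBl mulr_ge0// exprn_ge0// invr_ge0.
Qed.

(** Both sides are written as square roots and the radicands compared. There the count of
    [t]-dimensional spaces is squared and divided once by the prior, so a single factor of each of
    the two counts, at most [p^t] and [p^u], remains. *)
Lemma term_weight_small {R : realType} (d : R) {n p : nat} (X : 'M[R]_(n, p)) (M : R) (u t : nat) :
  4 <= d -> 8 * (d + 2) <= M -> (10 <= p)%N ->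
  (size (subspaces_dim X t))%:R *
     (Num.sqrt (term_weight d X (M * (maxn u 1)%:R * ln p%:R) u t) / Num.sqrt ((1 - 2 / 3) ^+ t))
   <= 2^-1 ^+ t * expR (- ln p%:R / 2).
Proof.
move=> d4 hM p10; set r := M * _ * _; set N := size _; set L := ln p%:R : R.
have p_ge : 10 <= p%:R :> R by rewrite (ler_nat R 10 p).
have p_gt0 : 0 < p%:R :> R by lra.
have pE : p%:R = expR L :> R by rewrite lnK// posrE.
have L0 : 0 <= L by rewrite ln_ge0//; lra.
have powE v : (p ^ v)%:R = expR (v%:R * L) :> R by rewrite natrX pE expRM_natl.
have [N0|N_gt0] := posnP N.
  by rewrite N0 mul0r mulr_ge0 ?expR_ge0// exprn_ge0// invr_ge0.
have N1 : 0 < N%:R :> R by rewrite ltr0n.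
have third : 0 < 1 - 2 / 3 :> R by lra.
have kge0 := term_weight_ge0 d X r u t.
have -> : N%:R * (Num.sqrt (term_weight d X r u t) / Num.sqrt ((1 - 2 / 3) ^+ t)) =
    Num.sqrt (N%:R ^+ 2 * (term_weight d X r u t / (1 - 2 / 3) ^+ t)).
  rewrite [RHS]sqrtrM ?sqr_ge0// sqrtr_sqr ger0_norm ?ltW//; congr (_ * _).
  by rewrite [RHS]sqrtrM// sqrtrV// exprn_ge0// ltW.
have -> : 2^-1 ^+ t * expR (- L / 2) = Num.sqrt (4^-1 ^+ t * expR (- L)).
  rewrite sqrtrM ?exprn_ge0 ?invr_ge0// sqrt_expR; congr (_ * _).
  have -> : 4^-1 ^+ t = (2^-1 ^+ t) ^+ 2 :> R.
    by rewrite -exprM mulnC exprM; congr (_ ^+ _); field.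
  by rewrite sqrtr_sqr ger0_norm// exprn_ge0// invr_ge0.
apply: ler_wsqrtr; rewrite /term_weight -/N.
set Z := \sum_(v < n.+1) expR (- d * v%:R * ln p%:R) : R.
have Z0 : 0 < Z.
  rewrite /Z big_ord_recl ltr_pwDl ?expR_gt0// sumr_ge0// => i _; exact: expR_ge0.
set Nu := size (subspaces_dim X u); set s := Num.sqrt (2 * pi) : R.
set c := Num.sqrt ((3 / 4) ^+ t) : R.
have pi4 : pi < 4 :> R by have := pihalf_lt2 R; lra.
have s_gt0 : 0 < s by rewrite sqrtr_gt0 mulr_gt0// pi_gt0.
have s_le3 : s <= 3.
  have -> : 3 = Num.sqrt (3 ^+ 2) :> R by rewrite sqrtr_sqr ger0_norm.
  by apply: ler_wsqrtr; lra.
have s_ge1 : 1 <= s.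
  rewrite -[leLHS]sqrtr1; apply: ler_wsqrtr; have := pi_ge2 R; lra.
have c0 : 0 < c by rewrite sqrtr_gt0 exprn_gt0//; lra.
have c_ge : 2^-1 ^+ t <= c.
  have -> : 2^-1 ^+ t = Num.sqrt ((2^-1 ^+ t) ^+ 2) :> R.
    by rewrite sqrtr_sqr ger0_norm// exprn_ge0// invr_ge0.
  apply: ler_wsqrtr; rewrite -exprM mulnC exprM; apply: lerXn2r; rewrite ?nnegrE; lra.
have -> : N%:R ^+ 2 * (pi_n d n p t / N%:R / (pi_n d n p u / Nu%:R) *
     (expR (- r / 8) * (s ^+ t / s ^+ u / c)) / (1 - 2 / 3) ^+ t) =
   (N%:R * Nu%:R * (expR (- d * t%:R * L - (- d * u%:R * L)) * expR (- r / 8))) *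
   (s ^+ t / (1 - 2 / 3) ^+ t / c) / s ^+ u.
  rewrite /pi_n -/Z -/L invf_div expRD expRN; field.
  by rewrite !gt_eqF ?expR_gt0 ?exprn_gt0.
have main1 : N%:R * Nu%:R * (expR (- d * t%:R * L - (- d * u%:R * L)) * expR (- r / 8)) <=
    expR (- L) * expR (- (2 * t%:R * L)).
  apply: (@le_trans _ _ (expR (t%:R * L) * expR (u%:R * L) *
     (expR (- d * t%:R * L - (- d * u%:R * L)) * expR (- r / 8)))).
    rewrite ler_wpM2r ?mulr_ge0 ?expR_ge0// ler_pM// -powE ler_nat; exact: size_subspaces_dim.
  rewrite -!expRD ler_expR /r.
  set m := (maxn u 1)%:R : R.
  have m1 : 1 <= m by rewrite (ler_nat R 1) leq_maxr.
  have mu : u%:R <= m by rewrite ler_nat leq_maxl.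
  have t_ge0 : 0 <= t%:R :> R by [].
  (* Since [u <= m], [1 <= m] and [M / 8 >= d + 2], the terms in [u] and [m] are at most [-1];
     [d >= 4] gives [t - d t <= - 2 t]. *)
  have h : t%:R + u%:R - d * t%:R + d * u%:R - M * m / 8 <= - 1 - 2 * t%:R by nra.
  have := ler_wpM2r L0 h; rewrite -/L; lra.
have main2 : s ^+ t / (1 - 2 / 3) ^+ t / c <= 25 ^+ t.
  (* Per dimension, [s <= 3] and the factor [3] from the determinant give [9 <= 25/2], and [1 / c]
     costs at most another [2]. *)
  rewrite ler_pdivrMr// -expr_div_n.
  apply: (@le_trans _ _ (25 ^+ t * 2^-1 ^+ t)); last by rewrite ler_wpM2l// exprn_ge0.
  rewrite -exprMn; apply: lerXn2r; rewrite ?nnegrE.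
  - by rewrite divr_ge0// ltW.
  - lra.
  - rewrite ler_pdivrMr//; lra.
(* Per dimension this is [25 / p^2 <= 1/4], the source of the threshold [10 <= p]. *)
have main3 : expR (- (2 * t%:R * L)) * 25 ^+ t <= 4^-1 ^+ t.
  have -> : expR (- (2 * t%:R * L)) = (p%:R ^- 2) ^+ t.
    by rewrite pE exprVn -exprM -expRM_natl -expRN natrM.
  rewrite -exprMn; apply: lerXn2r; rewrite ?nnegrE ?mulr_ge0 ?invr_ge0 ?exprn_ge0//; try lra.
  rewrite mulrC ler_pdivrMr ?exprn_gt0//; nra.
rewrite ler_pdivrMr ?exprn_gt0//.
apply: (@le_trans _ _ (4^-1 ^+ t * expR (- L))); last first.
  by rewrite ler_peMr ?exprn_ege1// mulr_ge0 ?expR_ge0// exprn_ge0// invr_ge0.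
apply: (@le_trans _ _ (expR (- L) * expR (- (2 * t%:R * L)) * 25 ^+ t)).
  apply: ler_pM => //.
  by apply: divr_ge0; rewrite ?(ltW c0)//; apply: divr_ge0; rewrite exprn_ge0// ltW.
by rewrite -mulrA mulrC ler_wpM2r ?expR_ge0.
Qed.

Theorem theorem9 (R : realType) (d : R) (hd : 4 <= d)
  (X : forall n p : nat, 'M[R]_(n, p)) :
  exists M0 : R, forall M : R, M0 <= M ->
  forall eps : R, 0 < eps ->
  exists N : nat, forall n p : nat, (N <= n)%N -> (N <= p)%N ->
    (ereal_sup [set expect (X n p) beta0
        (posterior d (X n p)
           [set g | (M * (maxn (t0 (X n p) beta0) 1)%:R * ln p%:R
                    < sqnorm (g - X n p *m beta0))%R])
      | beta0 in [set: 'cV[R]_p]] <= eps%:E)%E.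
Proof.
exists (8 * (d + 2)) => M hM eps eps0.
(* The total bound is [2 / sqrt p], which is at most [eps] once [p >= 4 / eps^2]. *)
exists (maxn 10 (Num.truncn (4 / eps ^+ 2)).+1) => n p _.
rewrite geq_max => /andP[p10 peps]; apply: ge_ereal_sup => _ [beta _ <-].
apply: le_trans (expect_posterior_le _ _ _ _) _; rewrite lee_fin.
apply: (@le_trans _ _ (\sum_(t < n.+1) 2^-1 ^+ t * expR (- ln p%:R / 2))).
  by apply: ler_sum => t _; exact: term_weight_small.
rewrite -mulr_suml; apply: (@le_trans _ _ (2 * expR (- ln p%:R / 2))).
  by rewrite ler_wpM2r ?expR_ge0// sum_half_pow_le2.
have p_gt0 : 0 < p%:R :> R by rewrite ltr0n (leq_trans _ p10).
rewrite -sqrt_expR expRN lnK ?posrE//.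
have -> : 2 = Num.sqrt (2 ^+ 2) :> R by rewrite sqrtr_sqr ger0_norm.
rewrite -sqrtrM ?sqr_ge0// -[eps]ger0_norm ?(ltW eps0)// -sqrtr_sqr.
apply: ler_wsqrtr; rewrite ler_pdivrMr// mulrC -ler_pdivrMr ?exprn_gt0//.
have -> : 2 ^+ 2 = 4 :> R by rewrite expr2; lra.
have /ltW := truncnS_gt (4 / eps ^+ 2); move/le_trans; apply.
by rewrite ler_nat.
Qed.
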